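(* For $n>4$, the principal $\mathrm{PGL}_3(\mathbb{C})$-bundle $F_n\to X_n$ is trivial.
   Context: $F_n\subset(\mathbb{CP}^2)^n$ is the space of ordered $n$-tuples of distinct points of $\mathbb{CP}^2$, no three of which lie on a line. $\mathrm{PGL}_3(\mathbb{C})$ acts on $F_n$ diagonally and freely, $X_n=F_n/\mathrm{PGL}_3(\mathbb{C})$, and the quotient map $F_n\to X_n$ is a principal $\mathrm{PGL}_3(\mathbb{C})$-bundle. *)

(* Defs.v *)
From HB Require Import structures.
From mathcomp Require Import all_boot all_order all_algebra.
From mathcomp Require Import all_classical all_reals all_analysis.
From mathcomp Require Import complex.

Set Implicit Arguments.
Unset Strict Implicit.
Unset Printing Implicit Defensive.

Import Order.TTheory GRing.Theory Num.Theory.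
Import numFieldTopology.Exports.

Local Open Scope classical_set_scope.
Local Open Scope quotient_scope.
Local Open Scope ring_scope.

(* As for PreTopologicalZmodule in mathcomp-analysis, this is only the join of
   the two structures: continuity of the operations is not recorded. *)
#[short(type="preTopologicalGroupType")]
HB.structure Definition PreTopologicalGroup := {G of Group G & Topological G}.

Definition homeomorphism (T U : topologicalType) (f : T -> U) : Prop :=
  continuous f /\
  exists g : U -> T, [/\ cancel f g, cancel g f & continuous g].

(* [act] is the left action of G on the total space E; on the product bundle
   B * G -> B, G acts by left translations of the second factor. *)
Definition trivial_principal_bundle (G : preTopologicalGroupType)
    (E B : topologicalType) (act : G -> E -> E) (p : E -> B) : Prop :=
  exists phi : B * G -> E,
    [/\ homeomorphism phi,
        forall b g, p (phi (b, g)) = b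
      & forall b g h, phi (b, (g * h)%g) = act g (phi (b, h))].

Section ProjectivePlane.
Variable K : numFieldType.

Definition nzvec : set 'cV[K]_3 := [set v | v != 0].
Definition GL3 : set 'M[K]_3 := [set A | A \in unitmx].

Definition proportional m n (A : set 'M[K]_(m, n)) (x y : A) : bool :=
  `[< exists2 c : K, c != 0 & val x = c *: val y >].

Lemma proportionalP m n (A : set 'M[K]_(m, n)) (x y : A) :
  reflect (exists2 c : K, c != 0 & val x = c *: val y) (proportional x y).
Proof. exact: asboolP. Qed.

Lemma proportional_refl m n (A : set 'M[K]_(m, n)) :
  reflexive (@proportional m n A).
Proof.
by move=> x; apply/proportionalP; exists 1; rewrite ?oner_neq0 ?scale1r.
Qed.

Lemma proportional_sym m n (A : set 'M[K]_(m, n)) :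
  symmetric (@proportional m n A).
Proof.
have sub x y : @proportional m n A x y -> proportional y x.
  move=> /proportionalP[c c0 xE]; apply/proportionalP; exists c^-1.
    by rewrite invr_eq0.
  by rewrite xE scalerA mulVf// scale1r.
by move=> x y; apply/idP/idP; exact: sub.
Qed.

Lemma proportional_trans m n (A : set 'M[K]_(m, n)) :
  transitive (@proportional m n A).
Proof.
move=> y x z /proportionalP[c c0 xE] /proportionalP[d d0 yE].
apply/proportionalP; exists (c * d); first by rewrite mulf_neq0.
by rewrite xE yE scalerA.
Qed.

Canonical proportional_equiv m n (A : set 'M[K]_(m, n)) :=
  EquivRel (@proportional m n A) (@proportional_refl m n A)
    (@proportional_sym m n A) (@proportional_trans m n A).

Definition P2 : Type := quotient_topology {eq_quot (@proportional 3 1 nzvec)}.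
HB.instance Definition _ := Quotient.on P2.
HB.instance Definition _ := Topological.on P2.

Definition PGL3 : Type := quotient_topology {eq_quot (@proportional 3 3 GL3)}.
HB.instance Definition _ := Quotient.on PGL3.
HB.instance Definition _ := Topological.on PGL3.

Lemma P2_eqP (v w : nzvec) :
  \pi_P2 v = \pi_P2 w <-> exists2 c : K, c != 0 & val v = c *: val w.
Proof.
split; first by move=> /(@eqquotP _ _ _ v w)/proportionalP.
by move=> vw; apply/(@eqquotP _ _ _ v w)/proportionalP.
Qed.

Lemma PGL3_eqP (A B : GL3) :
  \pi_PGL3 A = \pi_PGL3 B <-> exists2 c : K, c != 0 & val A = c *: val B.
Proof.
split; first by move=> /(@eqquotP _ _ _ A B)/proportionalP.
by move=> AB; apply/(@eqquotP _ _ _ A B)/proportionalP.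
Qed.

Lemma GL3_unit (A : GL3) : val A \in unitmx.
Proof. exact: set_mem (valP A). Qed.

Lemma nzvec_neq0 (v : nzvec) : val v != 0.
Proof. exact: set_mem (valP v). Qed.

Lemma GL3_one_subproof : (1%:M : 'M[K]_3) \in GL3.
Proof. by rewrite inE; exact: unitmx1. Qed.

Lemma GL3_mul_subproof (A B : GL3) : val A *m val B \in GL3.
Proof. by rewrite inE /GL3 /= unitmx_mul !GL3_unit. Qed.

Lemma GL3_inv_subproof (A : GL3) : invmx (val A) \in GL3.
Proof. by rewrite inE /GL3 /= unitmx_inv GL3_unit. Qed.

Lemma GL3_act_subproof (A : GL3) (v : nzvec) : val A *m val v \in nzvec.
Proof.
rewrite inE /nzvec /=; apply: contra_neq (nzvec_neq0 v) => Av0.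
by rewrite -(mulKmx (GL3_unit A) (val v)) Av0 mulmx0.
Qed.

Definition GL3_one : GL3 := SigSub GL3_one_subproof.
Definition GL3_mul (A B : GL3) : GL3 := SigSub (GL3_mul_subproof A B).
Definition GL3_inv (A : GL3) : GL3 := SigSub (GL3_inv_subproof A).
Definition GL3_act (A : GL3) (v : nzvec) : nzvec :=
  SigSub (GL3_act_subproof A v).

Definition PGL3_one : PGL3 := \pi_PGL3 GL3_one.
Definition PGL3_mul (g h : PGL3) : PGL3 := \pi_PGL3 (GL3_mul (repr g) (repr h)).
Definition PGL3_inv (g : PGL3) : PGL3 := \pi_PGL3 (GL3_inv (repr g)).
Definition P2_act (g : PGL3) (p : P2) : P2 := \pi_P2 (GL3_act (repr g) (repr p)).

Lemma repr_PGL3 (A : GL3) :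
  exists2 c : K, c != 0 & val (repr (\pi_PGL3 A)) = c *: val A.
Proof. by apply/PGL3_eqP; rewrite reprK. Qed.

Lemma repr_P2 (v : nzvec) :
  exists2 c : K, c != 0 & val (repr (\pi_P2 v)) = c *: val v.
Proof. by apply/P2_eqP; rewrite reprK. Qed.

Lemma PGL3_mulE (A B : GL3) :
  PGL3_mul (\pi_PGL3 A) (\pi_PGL3 B) = \pi_PGL3 (GL3_mul A B).
Proof.
have [c c0 cE] := repr_PGL3 A; have [d d0 dE] := repr_PGL3 B.
apply/PGL3_eqP; exists (c * d); first by rewrite mulf_neq0.
by rewrite /= cE dE -scalemxAl -scalemxAr scalerA.
Qed.

Lemma PGL3_invE (A : GL3) : PGL3_inv (\pi_PGL3 A) = \pi_PGL3 (GL3_inv A).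
Proof.
have [c c0 cE] := repr_PGL3 A.
apply/PGL3_eqP; exists c^-1; first by rewrite invr_eq0.
by rewrite /= cE invmxZ// -cE GL3_unit.
Qed.

Lemma P2_actE (A : GL3) (v : nzvec) :
  P2_act (\pi_PGL3 A) (\pi_P2 v) = \pi_P2 (GL3_act A v).
Proof.
have [c c0 cE] := repr_PGL3 A; have [d d0 dE] := repr_P2 v.
apply/P2_eqP; exists (c * d); first by rewrite mulf_neq0.
by rewrite /= cE dE -scalemxAl -scalemxAr scalerA.
Qed.

Lemma PGL3_mulA : associative PGL3_mul.
Proof.
move=> g h k; elim/quotW: g => A; elim/quotW: h => B; elim/quotW: k => C.
rewrite (PGL3_mulE B C) (PGL3_mulE A B) !PGL3_mulE.
by apply: (congr1 \pi_PGL3); apply: val_inj; rewrite /= mulmxA.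
Qed.

Lemma PGL3_mul1 : left_id PGL3_one PGL3_mul.
Proof.
elim/quotW => A; rewrite PGL3_mulE.
by apply: (congr1 \pi_PGL3); apply: val_inj; rewrite /= mul1mx.
Qed.

Lemma PGL3_mulr1 : right_id PGL3_one PGL3_mul.
Proof.
elim/quotW => A; rewrite PGL3_mulE.
by apply: (congr1 \pi_PGL3); apply: val_inj; rewrite /= mulmx1.
Qed.

Lemma PGL3_mulV : left_inverse PGL3_one PGL3_inv PGL3_mul.
Proof.
elim/quotW => A; rewrite PGL3_invE PGL3_mulE.
by apply: (congr1 \pi_PGL3); apply: val_inj; rewrite /= mulVmx// GL3_unit.
Qed.

Lemma PGL3_mulrV : right_inverse PGL3_one PGL3_inv PGL3_mul.
Proof.
elim/quotW => A; rewrite PGL3_invE PGL3_mulE.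
by apply: (congr1 \pi_PGL3); apply: val_inj; rewrite /= mulmxV// GL3_unit.
Qed.

HB.instance Definition _ := isGroup.Build PGL3
  PGL3_mulA PGL3_mul1 PGL3_mulr1 PGL3_mulV PGL3_mulrV.

Lemma P2_act1 (p : P2) : P2_act 1%g p = p.
Proof.
elim/quotW: p => v; rewrite P2_actE.
by apply: (congr1 \pi_P2); apply: val_inj; rewrite /= mul1mx.
Qed.

Lemma P2_actM (g h : PGL3) (p : P2) : P2_act (g * h)%g p = P2_act g (P2_act h p).
Proof.
elim/quotW: g => A; elim/quotW: h => B; elim/quotW: p => v.
rewrite [(_ * _)%g]PGL3_mulE (P2_actE B v) !P2_actE.
by apply: (congr1 \pi_P2); apply: val_inj; rewrite /= mulmxA.
Qed.

Lemma P2_actK (g : PGL3) : cancel (P2_act g) (P2_act g^-1%g).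
Proof. by move=> p; rewrite -P2_actM mulVg P2_act1. Qed.

Definition line (l : 'rV[K]_3) : set P2 := [set p | l *m val (repr p) = 0].

Lemma lineE (l : 'rV[K]_3) (v : nzvec) : line l (\pi_P2 v) <-> l *m val v = 0.
Proof.
have [c c0 cE] := repr_P2 v; rewrite /line /= cE -scalemxAr; split.
  by move/eqP; rewrite scaler_eq0 (negPf c0) => /eqP.
by move->; rewrite scaler0.
Qed.

Lemma line_act (l : 'rV[K]_3) (g : PGL3) (p : P2) :
  line l (P2_act g p) <-> line (l *m val (repr g)) p.
Proof. by rewrite lineE /line /= mulmxA. Qed.

Definition collinear (p q r : P2) : Prop :=
  exists2 l : 'rV[K]_3, l != 0 & [/\ line l p, line l q & line l r].

Lemma collinear_act (g : PGL3) (p q r : P2) :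
  collinear (P2_act g p) (P2_act g q) (P2_act g r) -> collinear p q r.
Proof.
move=> [l l0 [/line_act lp /line_act lq /line_act lr]].
exists (l *m val (repr g)) => //; apply: contra_neq l0 => lg0.
by rewrite -(mulmxK (GL3_unit (repr g)) l) lg0 mul0mx.
Qed.

Section Configurations.
Variable n : nat.

Definition Fconf : set (prod_topology (fun _ : 'I_n => P2)) :=
  [set x : prod_topology (fun _ : 'I_n => P2) | injective x /\
    forall i j k : 'I_n, i != j -> i != k -> j != k ->
      ~ collinear (x i) (x j) (x k)].

Lemma Fconf_act_subproof (g : PGL3) (x : Fconf) :
  ((fun i => P2_act g (val x i)) : prod_topology (fun _ : 'I_n => P2)) \in Fconf.
Proof.
have [xinj xcol] : Fconf (val x) by exact: set_mem (valP x).
rewrite inE; split=> [i j|i j k ij ik jk /collinear_act]; last exact: xcol.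
by move=> /(can_inj (P2_actK g))/xinj.
Qed.

Definition Fconf_act (g : PGL3) (x : Fconf) : Fconf :=
  SigSub (Fconf_act_subproof g x).

Lemma Fconf_act1 (x : Fconf) : Fconf_act 1%g x = x.
Proof. by apply/val_inj/funext => i; rewrite /= P2_act1. Qed.

Lemma Fconf_actM (g h : PGL3) (x : Fconf) :
  Fconf_act (g * h)%g x = Fconf_act g (Fconf_act h x).
Proof. by apply/val_inj/funext => i; rewrite /= P2_actM. Qed.

Definition same_orbit (x y : Fconf) : bool :=
  `[< exists g : PGL3, x = Fconf_act g y >].

Lemma same_orbit_refl : reflexive same_orbit.
Proof. by move=> x; apply/asboolP; exists 1%g; rewrite Fconf_act1. Qed.

Lemma same_orbit_sym : symmetric same_orbit.
Proof.
have sub x y : same_orbit x y -> same_orbit y x.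
  move=> /asboolP[g ->]; apply/asboolP; exists g^-1%g.
  by rewrite -Fconf_actM mulVg Fconf_act1.
by move=> x y; apply/idP/idP; exact: sub.
Qed.

Lemma same_orbit_trans : transitive same_orbit.
Proof.
move=> y x z /asboolP[g ->] /asboolP[h ->]; apply/asboolP; exists (g * h)%g.
by rewrite Fconf_actM.
Qed.

Canonical same_orbit_equiv :=
  EquivRel same_orbit same_orbit_refl same_orbit_sym same_orbit_trans.

Definition Xconf : Type := quotient_topology {eq_quot same_orbit}.
HB.instance Definition _ := Quotient.on Xconf.
HB.instance Definition _ := Topological.on Xconf.

Definition Fconf_quot : Fconf -> Xconf := \pi_Xconf.

End Configurations.
End ProjectivePlane.

(* Main.v *)
(** A trivialization amounts to a continuous map s : F_n -> PGL_3 with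
    s (g x) = g (s x): then (b, g) |-> g (s x)^-1 x, for any x over b, is an
    isomorphism, with inverse x |-> ([x], s x).  Such an s is given by the
    projective frame formed by the first four points: lift them to vectors
    u, v, w, t and take the matrix with columns |t v w| u, |u t w| v, |u v t| w.
    It is invertible since no three of the points are collinear, rescaling the
    lifts only rescales it, and applying B to the lifts multiplies it by
    (det B) B.  Being polynomial in the lifts it is continuous, and continuity
    passes to the projective quotients because the quotient maps are open. *)
Require Import Defs.
From mathcomp Require Import all_boot all_order all_algebra.
From mathcomp Require Import all_classical all_reals all_analysis.
From mathcomp Require Import complex ring.

Set Implicit Arguments.
Unset Strict Implicit.
Unset Printing Implicit Defensive.

Import Order.TTheory GRing.Theory Num.Theory.
Import numFieldNormedType.Exports.

Local Open Scope classical_set_scope.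
Local Open Scope quotient_scope.
Local Open Scope ring_scope.

(** * Products, subspaces and open maps *)

Section Topology.

Lemma prod_topology_continuous (I : Type) (T : I -> topologicalType)
    (X : topologicalType) (f : X -> prod_topology T) :
  (forall i, continuous (fun x => f x i)) -> continuous f.
Proof.
move=> cf x; apply/cvg_sup => i.
exact: (@continuous_comp_initial _ _ _ (fun g : forall i, T i => g i) f (cf i)).
Qed.

Lemma continuous_pair (X Y Z : topologicalType) (f : X -> Y) (g : X -> Z) :
  continuous f -> continuous g -> continuous (fun x => (f x, g x)).
Proof. by move=> cf cg x; apply: cvg_pair; [exact: cf|exact: cg]. Qed.

Lemma continuous_comp2 (X Y Z W : topologicalType) (h : Y -> Z -> W)
    (f : X -> Y) (g : X -> Z) :
  continuous (fun yz : Y * Z => h yz.1 yz.2) -> continuous f -> continuous g ->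
  continuous (fun x => h (f x) (g x)).
Proof.
move=> ch cf cg x; apply: (@continuous2_cvg _ _ _ _ _ _ _ _ h).
- exact: ch (f x, g x).
- exact: cf.
- exact: cg.
Qed.

Lemma set_type_continuous (X Y : topologicalType) (A : set Y) (f : X -> A) :
  continuous (fun x => val (f x)) -> continuous f.
Proof. exact: (@continuous_comp_initial _ _ _ set_val f). Qed.

Lemma set_val_continuous (X : topologicalType) (A : set X) :
  continuous (val : A -> X).
Proof. exact: (@initial_continuous _ _ (val : A -> X)). Qed.

Lemma set_val_comp_continuous (X Y : topologicalType) (A : set Y) (f : X -> A) :
  continuous f -> continuous (fun x => val (f x)).
Proof.
move=> cf x; apply: (@continuous_comp _ _ _ f val); first exact: cf.
exact: set_val_continuous.
Qed.

Lemma set_type_nbhs (X : topologicalType) (A : set X) (x : A) (U : set A) :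
  nbhs x U ->
  exists2 V : set X, nbhs (val x) V & forall y : A, V (val y) -> U y.
Proof.
move=> [_ [[V oV <-] Vx VU]]; exists V; first exact: open_nbhs_nbhs.
exact: VU.
Qed.

Definition open_map (X Y : topologicalType) (f : X -> Y) :=
  forall U : set X, open U -> open (f @` U).

Lemma open_map_nbhs (X Y : topologicalType) (f : X -> Y) x (U : set X) :
  open_map f -> nbhs x U -> nbhs (f x) (f @` U).
Proof.
move=> fo; rewrite nbhsE => -[V [oV Vx] VU].
apply: (@filterS _ _ _ (f @` V)); first exact: image_subset.
by apply: open_nbhs_nbhs; split; [exact: fo|exists x].
Qed.

(** A product of two open surjections is an open surjection, so continuity of [f] can be tested
    upstairs. Openness matters: a product of arbitrary quotient maps may fail to be a quotient
    map. *)
Lemma open_map_pair_continuous (X Y X' Y' Z : topologicalType)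
    (p : X -> X') (q : Y -> Y') (f : X' * Y' -> Z) :
  open_map p -> open_map q ->
  (forall x', exists x, p x = x') -> (forall y', exists y, q y = y') ->
  continuous (fun xy : X * Y => f (p xy.1, q xy.2)) -> continuous f.
Proof.
move=> po qo ps qs cf [x' y'] W.
have [x <-] := ps x'; have [y <-] := qs y' => /(cf (x, y))[[U V] [/= Ux Vy] UV].
exists (p @` U, q @` V); first by split=> /=; exact: open_map_nbhs.
by move=> [_ _] [/= [a Ua <-] [b Vb <-]]; exact: (UV (a, b)).
Qed.

End Topology.

(** * Continuity of polynomial matrix operations *)

Section MatrixContinuity.
Variables (K : numFieldType) (X : topologicalType).

Lemma mx_continuous m n (f : X -> 'M[K]_(m, n)) :
  (forall i j, continuous (fun x => f x i j)) -> continuous f.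
Proof.
move=> cf x U [P Pf PU]; apply: filterS PU _.
by apply: filter_forall => i; apply: filter_forall => j; exact: cf.
Qed.

Lemma mx_entry_continuous m n (f : X -> 'M[K]_(m, n)) i j :
  continuous f -> continuous (fun x => f x i j).
Proof.
move=> cf x; apply: (@continuous_comp _ _ _ f (fun M => M i j)).
  exact: cf.
exact: coord_continuous.
Qed.

Lemma mulr_fun_continuous (f g : X -> K) :
  continuous f -> continuous g -> continuous (fun x => f x * g x).
Proof. by move=> cf cg x; apply: cvgM; [exact: cf|exact: cg]. Qed.

Lemma sum_continuous (I : Type) (r : seq I) (P : pred I) (f : I -> X -> K) :
  (forall i, P i -> continuous (f i)) ->
  continuous (fun x => \sum_(i <- r | P i) f i x).
Proof. by apply: continuous_big; exact: add_continuous. Qed.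

Lemma prod_continuous (I : Type) (r : seq I) (P : pred I) (f : I -> X -> K) :
  (forall i, P i -> continuous (f i)) ->
  continuous (fun x => \prod_(i <- r | P i) f i x).
Proof. by apply: continuous_big; exact: mul_continuous. Qed.

Lemma scalemx_continuous m n (a : X -> K) (f : X -> 'M[K]_(m, n)) :
  continuous a -> continuous f -> continuous (fun x => a x *: f x).
Proof.
move=> ca cf; apply: mx_continuous => i j.
under [X in continuous X]eq_fun do rewrite mxE.
by apply: mulr_fun_continuous => //; exact: mx_entry_continuous.
Qed.

Lemma mulmx_continuous m n p (f : X -> 'M[K]_(m, n)) (g : X -> 'M[K]_(n, p)) :
  continuous f -> continuous g -> continuous (fun x => f x *m g x).
Proof.
move=> cf cg; apply: mx_continuous => i j.
under [X in continuous X]eq_fun do rewrite mxE.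
apply: sum_continuous => k _.
by apply: mulr_fun_continuous; exact: mx_entry_continuous.
Qed.

(** The Leibniz formula, to which [\det] unfolds, is a polynomial in the entries. *)
Lemma det_continuous n (f : X -> 'M[K]_n) :
  continuous f -> continuous (fun x => \det (f x)).
Proof.
move=> cf; apply: sum_continuous => s _; apply: mulr_fun_continuous.
  by move=> x; exact: cvg_cst.
by apply: prod_continuous => i _; exact: mx_entry_continuous.
Qed.

Lemma adj_continuous n (f : X -> 'M[K]_n) :
  continuous f -> continuous (fun x => \adj (f x)).
Proof.
move=> cf; apply: mx_continuous => i j.
under [X in continuous X]eq_fun do rewrite mxE /cofactor.
apply: mulr_fun_continuous; first by move=> x; exact: cvg_cst.
apply: det_continuous; apply: mx_continuous => k l.
under [X in continuous X]eq_fun do rewrite !mxE.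
exact: mx_entry_continuous.
Qed.

End MatrixContinuity.

(** * Topology of the projective quotients *)

Section ProjectiveQuotients.
Variable K : numFieldType.

(** The saturation of an open set is the union of its preimages under all nonzero scalings.
    Stability of [A] under scaling keeps the rescaled matrices in [A]. *)
Lemma proportional_open m n (A : set 'M[K]_(m, n)) :
  (forall c M, c != 0 -> A M -> A (c *: M)) ->
  open_map
    (\pi : A -> quotient_topology {eq_quot (@proportional K m n A)}).
Proof.
move=> AZ _ [V oV <-].
pose S c := [set M : 'M[K]_(m, n) | V (c *: M)].
(* Open in the quotient means open preimage in [A], that is, the trace on [A] of an open set of
   matrices; the union of the [S c] is such a set. *)
rewrite /open /= /quotient_open.
exists (\bigcup_(c in [set c : K | c != 0]) S c).
  apply: bigcup_open => c _; apply: (open_comp _ oV) => M _.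
  apply: (@scalemx_continuous _ _ _ _ (fun=> c) id) => x.
    exact: cst_continuous.
  exact: cvg_id.
apply/seteqP; split=> [y [c /= c0 Vcy]|y [x Vx xy]].
  have Acy : c *: val y \in A.
    by rewrite inE; apply: AZ => //; exact: set_mem (valP y).
  exists (SigSub Acy : A); first exact: Vcy.
  by apply/eqmodP/proportionalP; exists c.
have /eqmodP/proportionalP[c c0 xE] := xy.
by exists c => //; rewrite /S /= -xE.
Qed.

Lemma P2_pi_open : open_map (\pi_(P2 K) : nzvec (K := K) -> P2 K).
Proof.
apply: proportional_open => c M c0 M0.
by rewrite /nzvec /= scaler_eq0 negb_or c0.
Qed.

Lemma PGL3_pi_open : open_map (\pi_(PGL3 K) : GL3 (K := K) -> PGL3 K).
Proof.
apply: proportional_open => c M c0 M0.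
by rewrite /GL3 /= unitmxZ// unitfE.
Qed.

Lemma P2_pi_continuous : continuous (\pi_(P2 K) : nzvec (K := K) -> P2 K).
Proof. exact: pi_continuous. Qed.

Lemma PGL3_pi_continuous : continuous (\pi_(PGL3 K) : GL3 (K := K) -> PGL3 K).
Proof. exact: pi_continuous. Qed.

(** The action is induced by the matrix-vector product along two open quotient maps. *)
Lemma P2_act_continuous :
  continuous (fun gp : PGL3 K * P2 K => P2_act gp.1 gp.2).
Proof.
apply: (open_map_pair_continuous PGL3_pi_open P2_pi_open).
- by move=> g; exists (repr g); rewrite reprK.
- by move=> p; exists (repr p); rewrite reprK.
have -> : (fun xy : GL3 (K := K) * nzvec (K := K) =>
    P2_act (\pi_(PGL3 K) xy.1, \pi_(P2 K) xy.2).1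
      (\pi_(PGL3 K) xy.1, \pi_(P2 K) xy.2).2) =
    \pi_(P2 K) \o (fun xy => GL3_act xy.1 xy.2).
  by apply/funext => xy /=; rewrite P2_actE.
move=> x; apply: continuous_comp; last exact: P2_pi_continuous.
apply: (@set_type_continuous _ _ _
  (fun xy : GL3 (K := K) * nzvec (K := K) => GL3_act xy.1 xy.2)).
apply: mulmx_continuous; apply: set_val_comp_continuous => y.
  exact: cvg_fst.
exact: cvg_snd.
Qed.

(* The inverse is also the class of the adjugate, which is polynomial. *)
Lemma PGL3_inv_continuous : continuous (@PGL3_inv K).
Proof.
have adjG (A : GL3 (K := K)) : \adj (val A) \in GL3 (K := K).
  have : \det (val A) *: invmx (val A) \in GL3 (K := K).
    rewrite inE /GL3 /= unitmxZ ?unitmx_inv ?GL3_unit//.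
    by have := GL3_unit A; rewrite unitmxE.
  rewrite /invmx GL3_unit scalerA divff ?scale1r//.
  by have := GL3_unit A; rewrite unitmxE unitfE.
apply/quotient_continuous.
have -> : @PGL3_inv K \o \pi_(PGL3 K) =
    \pi_(PGL3 K) \o (fun A => SigSub (adjG A) : GL3 (K := K)).
  apply/funext => A /=; rewrite PGL3_invE; apply/PGL3_eqP.
  exists (\det (val A))^-1.
    by have := GL3_unit A; rewrite unitmxE unitfE invr_eq0.
  by rewrite /= /invmx GL3_unit.
move=> A; apply: continuous_comp; last exact: PGL3_pi_continuous.
apply: set_type_continuous; apply: adj_continuous; exact: set_val_continuous.
Qed.

End ProjectiveQuotients.

(** * The frame matrix of four vectors *)

Section Frame.
Variable K : numFieldType.
Implicit Types (u v w t : 'cV[K]_3) (B : 'M[K]_3).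

Definition mx3 u v w : 'M[K]_3 := \matrix_(i, j) (nth 0 [:: u; v; w] j) i 0.

Lemma mulmx_mx3 B u v w : B *m mx3 u v w = mx3 (B *m u) (B *m v) (B *m w).
Proof.
apply/matrixP => i j; rewrite !mxE.
by case: j => [[|[|[|//]]] ?] /=; rewrite mxE;
  apply: eq_bigr => k _; rewrite mxE.
Qed.

Lemma mx3Z a u v w : mx3 (a *: u) (a *: v) (a *: w) = a *: mx3 u v w.
Proof. by rewrite -!mul_scalar_mx mulmx_mx3. Qed.

(** Rescaling columns is right multiplication by a diagonal matrix. *)
Lemma det_mx3Z a b c u v w :
  \det (mx3 (a *: u) (b *: v) (c *: w)) = a * b * c * \det (mx3 u v w).
Proof.
have -> : mx3 (a *: u) (b *: v) (c *: w) =
    mx3 u v w *m diag_mx (\row_j nth 0 [:: a; b; c] j).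
  apply/matrixP => i j; rewrite mul_mx_diag !mxE.
  by case: j => [[|[|[|//]]] ?] /=; rewrite mxE mulrC.
rewrite det_mulmx det_diag !big_ord_recl big_ord0 !mxE /=.
by rewrite mulr1 mulrA mulrC.
Qed.

(* By Cramer's rule this matrix maps the standard projective frame e1, e2, e3,
   e1 + e2 + e3 to the classes of u, v, w, t. *)
Definition frame u v w t : 'M[K]_3 :=
  mx3 (\det (mx3 t v w) *: u) (\det (mx3 u t w) *: v) (\det (mx3 u v t) *: w).

Lemma frame_mulmx B u v w t :
  frame (B *m u) (B *m v) (B *m w) (B *m t) = \det B *: (B *m frame u v w t).
Proof.
rewrite /frame -!mulmx_mx3 !det_mulmx mulmx_mx3 -mx3Z.
by rewrite -!scalemxAr !scalerA.
Qed.

(** Each column is linear in each of the four vectors, so all three columns acquire the same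
    factor. *)
Lemma frameZ a b c d u v w t :
  frame (a *: u) (b *: v) (c *: w) (d *: t) = (a * b * c * d) *: frame u v w t.
Proof.
rewrite /frame !det_mx3Z -mx3Z !scalerA.
by congr mx3; congr (_ *: _); ring.
Qed.

(** The determinant of the frame is the product of the four determinants assumed nonzero. *)
Lemma frame_unit u v w t :
  \det (mx3 t v w) != 0 -> \det (mx3 u t w) != 0 -> \det (mx3 u v t) != 0 ->
  \det (mx3 u v w) != 0 -> frame u v w t \in unitmx.
Proof.
move=> a0 b0 c0 d0.
by rewrite unitmxE unitfE det_mx3Z !mulf_neq0.
Qed.

Lemma mx3_continuous (X : topologicalType) (f g h : X -> 'cV[K]_3) :
  continuous f -> continuous g -> continuous h ->
  continuous (fun x => mx3 (f x) (g x) (h x)).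
Proof.
move=> cf cg ch; apply: mx_continuous => i j.
under [X in continuous X]eq_fun do rewrite mxE.
by case: j => [[|[|[|//]]] ?] /=; exact: mx_entry_continuous.
Qed.

Lemma frame_continuous (X : topologicalType) (f g h k : X -> 'cV[K]_3) :
  continuous f -> continuous g -> continuous h -> continuous k ->
  continuous (fun x => frame (f x) (g x) (h x) (k x)).
Proof.
move=> cf cg ch ck.
by apply: mx3_continuous; apply: scalemx_continuous => //;
  apply: det_continuous; exact: mx3_continuous.
Qed.

(** A nonzero row vector in the left kernel of a singular matrix is the equation of a line through
    the points of its columns. *)
Lemma noncollinear_det (u v w : nzvec (K := K)) :
  ~ collinear (\pi_(P2 K) u) (\pi_(P2 K) v) (\pi_(P2 K) w) ->
  \det (mx3 (val u) (val v) (val w)) != 0.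
Proof.
apply: contra_notN => /det0P[l l0 lM]; exists l => //.
have lE (j : 'I_3) : l *m nth 0 [:: val u; val v; val w] j = 0.
  apply/matrixP => i k; rewrite !ord1 {i k}.
  have /matrixP/(_ 0 j) := lM; rewrite !mxE; apply: etrans.
  by apply: eq_bigr => i _; rewrite !mxE.
by split; apply/lineE; [exact: (lE 0)|exact: (lE 1)|exact: (lE ord_max)].
Qed.

End Frame.

(** * The equivariant map from configurations to the group *)

Lemma Fconf_coord_continuous (K : numFieldType) (n : nat) (i : 'I_n) :
  continuous (fun x : Fconf (K := K) (n := n) => val x i).
Proof.
move=> x; apply: (@continuous_comp (Fconf (K := K) (n := n))
  (prod_topology (fun _ : 'I_n => P2 K)) (P2 K) val (fun f => f i)).
  exact: set_val_continuous.
exact: (@proj_continuous _ (fun _ : 'I_n => P2 K) i).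
Qed.

Section ConfigurationFrame.
Variables (K : numFieldType) (n : nat) (i0 i1 i2 i3 : 'I_n).
Hypothesis i_uniq : uniq [:: i0; i1; i2; i3].

(** Arbitrary lifts are allowed, because equivariance and continuity below are proved with lifts
    other than those chosen by [repr]. *)
Lemma frame_lift_subproof (x : Fconf (K := K) (n := n))
    (u v w t : nzvec (K := K)) :
  \pi_(P2 K) u = val x i0 -> \pi_(P2 K) v = val x i1 ->
  \pi_(P2 K) w = val x i2 -> \pi_(P2 K) t = val x i3 ->
  frame (val u) (val v) (val w) (val t) \in GL3 (K := K).
Proof.
have [_ xcol] : Fconf (val x) by exact: set_mem (valP x).
move=> ux vx wx tx; rewrite inE; move: i_uniq; rewrite /= !inE !negb_or.
move=> /and4P[/and3P[i01 i02 i03] /andP[i12 i13] i23 _].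
by apply: frame_unit; apply: noncollinear_det; rewrite ?ux ?vx ?wx ?tx;
  apply: xcol => //; rewrite eq_sym.
Qed.

Definition config_frame (x : Fconf (K := K) (n := n)) : PGL3 K :=
  \pi_(PGL3 K) (SigSub (frame_lift_subproof (reprK (val x i0))
    (reprK (val x i1)) (reprK (val x i2)) (reprK (val x i3)))).

Lemma config_frameE (x : Fconf (K := K) (n := n)) (u v w t : nzvec (K := K))
    (ux : \pi_(P2 K) u = val x i0) (vx : \pi_(P2 K) v = val x i1)
    (wx : \pi_(P2 K) w = val x i2) (tx : \pi_(P2 K) t = val x i3) :
  config_frame x = \pi_(PGL3 K) (SigSub (frame_lift_subproof ux vx wx tx)).
Proof.
have lift i (z : nzvec (K := K)) : \pi_(P2 K) z = val x i ->
    exists2 c : K, c != 0 & val (repr (val x i)) = c *: val z.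
  by move=> zx; apply/P2_eqP; rewrite reprK.
have [[a a0 aE] [b b0 bE]] := (lift _ _ ux, lift _ _ vx).
have [[c c0 cE] [d d0 dE]] := (lift _ _ wx, lift _ _ tx).
apply/PGL3_eqP; exists (a * b * c * d); first by rewrite !mulf_neq0.
by rewrite /= aE bE cE dE frameZ.
Qed.

(** If [A] represents [g], multiplying lifts of [x] by [A] gives lifts of its translate; the
    resulting factor [\det A] vanishes in the projective group. *)
Lemma config_frame_act (g : PGL3 K) (x : Fconf (K := K) (n := n)) :
  config_frame (Fconf_act g x) = (g * config_frame x)%g.
Proof.
elim/quotW: g => A.
have act i : \pi_(P2 K) (GL3_act A (repr (val x i))) =
    val (Fconf_act (\pi_(PGL3 K) A) x) i.
  by rewrite /= -P2_actE reprK.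
rewrite (config_frameE (act i0) (act i1) (act i2) (act i3)).
rewrite [(_ * _)%g]PGL3_mulE; apply/PGL3_eqP; exists (\det (val A)).
  by have := GL3_unit A; rewrite unitmxE unitfE.
by rewrite /= frame_mulmx.
Qed.

(** As [repr] need not be continuous, the frame at a nearby configuration is computed from lifts
    close to those of [x]. *)
Lemma config_frame_continuous : continuous config_frame.
Proof.
move=> x W /PGL3_pi_continuous /set_type_nbhs[V /= Vx VW].
set v := fun i => repr (val x i).
have cF : continuous (fun z : nzvec (K := K) * nzvec (K := K) *
    (nzvec (K := K) * nzvec (K := K)) =>
    frame (val z.1.1) (val z.1.2) (val z.2.1) (val z.2.2)).
  by apply: frame_continuous; apply: set_val_comp_continuous => z;
    apply: continuous_comp; (exact: cvg_fst || exact: cvg_snd).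
have /= := cF ((v i0, v i1), (v i2, v i3)) V Vx.
move=> [[P Q] /= [[[U0 U1] /= [U0v U1v] U01P] [[U2 U3] /= [U2v U3v] U23Q]] PQV].
(* Openness of the projection onto the plane provides lifts in [U] for the [i]-th point of every
   configuration near [x]. *)
have near i (U : set (nzvec (K := K))) : nbhs (v i) U ->
    nbhs x [set y | exists2 z, U z & \pi_(P2 K) z = val y i].
  move=> /(open_map_nbhs (@P2_pi_open K)); rewrite /v reprK => Ux.
  exact: Fconf_coord_continuous Ux.
have x_filter : Filter (nbhs x) := nbhs_filter x.
have near01 := @filterI _ _ x_filter _ _ (near _ _ U0v) (near _ _ U1v).
have near23 := @filterI _ _ x_filter _ _ (near _ _ U2v) (near _ _ U3v).
suff: nbhs x (config_frame @^-1` W) by [].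
apply: (@filterS _ _ x_filter _ _ _
  (@filterI _ _ x_filter _ _ near01 near23)) => y.
move=> [[[z0 Uz0 zy0] [z1 Uz1 zy1]] [[z2 Uz2 zy2] [z3 Uz3 zy3]]].
rewrite /= (config_frameE zy0 zy1 zy2 zy3); apply: VW => /=.
apply: (PQV ((z0, z1), (z2, z3))); split => /=.
  exact: (U01P (z0, z1)).
exact: (U23Q (z2, z3)).
Qed.

End ConfigurationFrame.

(** * From an equivariant map to a trivialization *)

Section Trivialization.
Variables (K : numFieldType) (n : nat).

Lemma Fconf_act_continuous :
  continuous (fun gx : PGL3 K * Fconf (K := K) (n := n) => Fconf_act gx.1 gx.2).
Proof.
apply: (@set_type_continuous _ _ _
  (fun gx : PGL3 K * Fconf (K := K) (n := n) => Fconf_act gx.1 gx.2)).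
apply: prod_topology_continuous => i.
apply: (@continuous_comp2 _ (PGL3 K) (P2 K) _ (@P2_act K) fst
  (fun gx : PGL3 K * Fconf (K := K) (n := n) => val gx.2 i)).
- exact: P2_act_continuous.
- by move=> gx; exact: cvg_fst.
- move=> gx; apply: (@continuous_comp _ (Fconf (K := K) (n := n)) (P2 K) snd
    (fun x => val x i)); first exact: cvg_snd.
  exact: Fconf_coord_continuous.
Qed.

Lemma equivariant_trivial (s : Fconf (K := K) (n := n) -> PGL3 K) :
  continuous s -> (forall g x, s (Fconf_act g x) = (g * s x)%g) ->
  @trivial_principal_bundle (PGL3 K) (Fconf (K := K) (n := n)) (Xconf K n)
    (@Fconf_act K n) (@Fconf_quot K n).
Proof.
move=> cs sM.
(* By equivariance, [c x] is the only point of the orbit of [x] where [s] takes the value 1. *)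
pose c x := Fconf_act (s x)^-1%g x.
have cact g x : c (Fconf_act g x) = c x.
  by rewrite /c sM -Fconf_actM invgM -mulgA mulVg mulg1.
have piE (x y : Fconf (K := K) (n := n)) :
    Fconf_quot x = Fconf_quot y -> exists g, x = Fconf_act g y.
  by move=> /eqmodP/asboolP.
have pi_act g (x : Fconf (K := K) (n := n)) :
    Fconf_quot (Fconf_act g x) = Fconf_quot x.
  by apply/eqmodP/asboolP; exists g.
have c_pi x : c (repr (Fconf_quot x)) = c x.
  have /piE[g ->] : Fconf_quot (repr (Fconf_quot x)) = Fconf_quot x.
    exact: reprK.
  exact: cact.
have cc : continuous c.
  apply: (@continuous_comp2 _ (PGL3 K) _ _ (@Fconf_act K n)
    (fun x => (s x)^-1%g) id).
  - exact: Fconf_act_continuous.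
  - move=> x; apply: (@continuous_comp _ (PGL3 K) (PGL3 K) s (@PGL3_inv K)).
      exact: cs.
    exact: PGL3_inv_continuous.
  - by move=> x; exact: cvg_id.
(* Since [c] is constant on orbits, it descends to the quotient whatever [repr] chooses; this is a
   continuous global section. *)
have cr : continuous (fun b : Xconf K n => c (repr b)).
  apply: repr_comp_continuous cc _ => x y /eqP/piE[g ->].
  by rewrite cact.
exists (fun bg => Fconf_act bg.2 (c (repr bg.1))); split.
- split.
    apply: (@continuous_comp2 _ (PGL3 K) _ _ (@Fconf_act K n) snd
      (fun bg : Xconf K n * PGL3 K => c (repr bg.1))).
    + exact: Fconf_act_continuous.
    + by move=> bg; exact: cvg_snd.
    + move=> bg; apply: (@continuous_comp _ (Xconf K n) _ fst
        (fun b => c (repr b))); first exact: cvg_fst.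
      exact: cr.
  exists (fun x => (Fconf_quot x, s x)); split.
  + move=> [b g] /=; rewrite /c !pi_act !sM mulVg mulg1.
    by congr pair; exact: reprK.
  + by move=> x /=; rewrite c_pi /c -Fconf_actM mulgV Fconf_act1.
  + by apply: continuous_pair; [exact: pi_continuous|exact: cs].
- by move=> b g /=; rewrite !pi_act; exact: reprK.
- by move=> b g h /=; rewrite Fconf_actM.
Qed.

End Trivialization.

Local Open Scope complex_scope.

Theorem proposition2p7 (R : realType) (n : nat) (n_gt4 : (4 < n)%N) :
  @trivial_principal_bundle (PGL3 R[i]) (@Fconf R[i] n) (Xconf R[i] n)
    (@Fconf_act R[i] n) (@Fconf_quot R[i] n).
Proof.
(* The frame uses the points of indices 0, 1, 2, 3, which are below [n] by [n_gt4]. *)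
pose o k (k4 : (k < 4)%N) := Ordinal (ltn_trans k4 n_gt4).
have i_uniq : uniq [:: @o 0 isT; @o 1 isT; @o 2 isT; @o 3 isT] by [].
apply: (@equivariant_trivial R[i] n (config_frame i_uniq)).
  exact: config_frame_continuous.
exact: config_frame_act.
Qed.
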